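(* Let $M$ be a matroid with cycle system $\mathcal{C}=\{C_1,\dots,C_g\}$, and let $D$ be a circuit of $M$. If $\mathcal{C}^D_{\ge3}$ is independent, then $|\mathcal{S}_D|=1$.
   Context: Matroids are on finite ground sets; $E(M)$ is the ground set and $r(M)$ the rank. A set is dependent if it is not independent. A cycle of $M$ is a subset of $E(M)$ that can be expressed as a union of circuits. The corank of $M$ is $g=|E(M)|-r(M)$. For subsets $A_1,\dots,A_k$ of a set $E$ and $S\subseteq[k]=\{1,\dots,k\}$, the unique union $\mathcal{A}_S=\ast\{A_i: i\in S\}$ is the set of elements of $E$ that belong to exactly one of the sets $A_i$, $i\in S$. A cycle system on a matroid $M$ of corank $g$ is a collection $\mathcal{C}=\{C_1,\dots,C_g\}$ of $g$ cycles of $M$ such that for every nonempty $S\subseteq[g]$ the unique union $\mathcal{C}_S=\ast\{C_i:i\in S\}$ is dependent in $M$. For a circuit $D$ of $M$, $\mathcal{S}_D=\{S\subseteq[g]:\mathcal{C}_S=D\}$; it is known that $\mathcal{S}_D$ is nonempty and closed under unions, so it has a unique inclusion-wise maximal element $S_D^{\max}$. Put $\mathcal{C}^D=\{C_i:i\in S_D^{\max}\}$. (Equivalently, $\mathcal{C}^D$ is the unique cycle system with total unique union $D$ obtainable from $\mathcal{C}$ by successively choosing an element $e$ lying in exactly one cycle of the current system and removing that cycle from the system and $e$ from the matroid.) $\mathcal{C}^D_{\ge3}$ denotes the set of elements of $E(M)$ that belong to at least $3$ of the cycles in $\mathcal{C}^D$. *)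

(* Defs.v *)
From HB Require Import structures.
From mathcomp Require Import all_boot.

Set Implicit Arguments.
Unset Strict Implicit.
Unset Printing Implicit Defensive.

(* The ground set is a subset of a finite type, rather than the whole type, so
   that deletions of a matroid live over the same type. *)
Record matroid (T : finType) := Matroid {
  ground : {set T};
  indep : pred {set T};
  indep_ground : forall X : {set T}, indep X -> X \subset ground;
  indep0 : indep set0;
  indepS : forall X Y : {set T}, X \subset Y -> indep Y -> indep X;
  indep_aug : forall X Y : {set T}, indep X -> indep Y -> #|X| < #|Y| ->
    exists2 y, y \in Y :\: X & indep (y |: X)
}.

Section MatroidNotions.
Variables (T : finType) (M : matroid T).

Definition rank : nat := \max_(X : {set T} | indep M X) #|X|.

Definition corank : nat := #|ground M| - rank.

Definition dependent (X : {set T}) : bool :=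
  (X \subset ground M) && ~~ indep M X.

Definition circuit (X : {set T}) : bool := minset dependent X.

Definition matroid_cycle (X : {set T}) : Prop :=
  exists2 P : {set {set T}}, (forall Y, Y \in P -> circuit Y) & X = cover P.

End MatroidNotions.

Section CycleSystems.
Variables (T : finType) (M : matroid T).

Definition unique_union (I : finType) (A : I -> {set T}) (S : {set I}) :
    {set T} :=
  [set e | #|[set i in S | e \in A i]| == 1].

(* The C i are automatically pairwise distinct: if i != j and C i = C j, then
   the unique union over {i, j} is empty, hence not dependent.  So indexed
   families are the same as collections of corank M cycles. *)
Definition cycle_system (C : 'I_(corank M) -> {set T}) : Prop :=
  (forall i, matroid_cycle M (C i)) /\
  (forall S : {set 'I_(corank M)}, S != set0 -> dependent M (unique_union C S)).

Variable C : 'I_(corank M) -> {set T}.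

Definition unique_union_fibre (D : {set T}) : {set {set 'I_(corank M)}} :=
  [set S | unique_union C S == D].

(* When C is a cycle system and D a circuit, unique_union_fibre D is nonempty
   and closed under unions, so the picked set is its unique maximal element;
   the default value set0 is then irrelevant. *)
Definition max_support (D : {set T}) : {set 'I_(corank M)} :=
  odflt set0 [pick S | maxset [in unique_union_fibre D] S].

(* The elements lying in at least k cycles C i with i in max_support D. *)
Definition cover_ge (D : {set T}) (k : nat) : {set T} :=
  [set e | k <= #|[set i in max_support D | e \in C i]|].

End CycleSystems.

(* Main.v *)
Require Import Defs.
From HB Require Import structures.
From mathcomp Require Import all_boot.

Set Implicit Arguments.
Unset Strict Implicit.
Unset Printing Implicit Defensive.

(** Suppose that [S] is the greatest index set with unique union [D], and that
    a proper subset [S'] of [S] also has unique union [D].  An element covered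
    exactly once by the nonempty remainder [S :\: S'] cannot be covered by [S']
    zero times (it would be in [D] by [S] but not by [S']) nor once (in [D] by
    [S'] but not by [S]), so it is covered at least three times by [S]
    ([unique_union_setD_cover3]).  The unique union of the remainder is
    dependent, so the set of elements covered at least three times is dependent
    as well.

    The other ingredient is that a greatest index set exists
    ([greatest_support]).  It is found greedily: as long as the current unique
    union is not [D], it has an element [e] outside [D], since a dependent set
    inside a circuit is that circuit.  Drop the only current cycle through [e],
    and delete [e] from the current ground set [X].  An index set below the
    current one that contained the dropped index would cover [e] exactly once,
    so its unique union would not be [D]; hence every index set with unique
    union [D] stays below the current one.  As [e] lies in a circuit inside
    [X], deleting it does not lower the rank ([indep_avoid_circuit_elt]), so the
    number of remaining cycles stays at least the corank of [X]; this is
    positive because [D \subset X] is dependent.  Thus the cycles never run out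
    before the process stops, which it can only do at [D]. *)

Section Matroids.
Variables (T : finType) (M : matroid T).
Implicit Types X Y Z K D J : {set T}.

Lemma indep_extend X Y : indep M X -> indep M Y ->
  exists Z, [/\ indep M Z, X \subset Z, Z \subset X :|: Y & #|Y| <= #|Z|].
Proof.
move=> + iY; have [n] := ubnP (#|Y| - #|X|).
elim: n X => // n IHn X ltYXn iX.
have [leYX | ltXY] := leqP #|Y| #|X|; first by exists X; rewrite subsetUl.
have [y /setDP[yY yX] iyX] := indep_aug iX iY ltXY.
have lt_n : #|Y| - #|y |: X| < n.
  by rewrite cardsU1 yX add1n subnS prednK ?subn_gt0 // -ltnS.
have [Z [iZ sXZ sZ leYZ]] := IHn _ lt_n iyX.
exists Z; split=> //; first exact: subset_trans (subsetUr _ _) sXZ.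
apply: subset_trans sZ _; rewrite !subUset subsetUl subsetUr !andbT sub1set.
by rewrite inE yY orbT.
Qed.

Lemma circuit_dependent K : circuit M K -> dependent M K.
Proof. by case/minsetP. Qed.

Lemma circuit_setD1_indep K e : circuit M K -> e \in K -> indep M (K :\ e).
Proof.
move=> /minsetP[/andP[sKE _] minK] eK; apply/negPn/negP => depKe.
have KeK : K :\ e = K.
  by apply: minK (subD1set _ _); rewrite /dependent (subset_trans (subD1set _ _)).
by move: eK; rewrite -KeK setD11.
Qed.

(** An element of a circuit inside [X] is not a coloop of [X]: an
    independent set grown from the rest of the circuit to at least the size of
    [J] must miss it. *)
Lemma indep_avoid_circuit_elt X K J e :
    circuit M K -> K \subset X -> e \in K -> indep M J -> J \subset X ->
  exists J', [/\ indep M J', J' \subset X :\ e & #|J| <= #|J'|].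
Proof.
move=> cK sKX eK iJ sJX.
have [Z [iZ sKZ sZ leJZ]] := indep_extend (circuit_setD1_indep cK eK) iJ.
exists Z; split=> //; rewrite subsetD1; apply/andP; split.
  apply: subset_trans sZ _.
  by rewrite subUset sJX (subset_trans (subD1set _ _)).
apply/negP=> eZ; have /andP[_ /negP[]] := circuit_dependent cK.
by apply: indepS iZ; rewrite -(setD1K eK) subUset sub1set eZ.
Qed.

Lemma matroid_cycle_circuit X e : matroid_cycle M X -> e \in X ->
  exists K, [/\ circuit M K, K \subset X & e \in K].
Proof.
case=> P cP -> /bigcupP[K KP eK].
by exists K; split; rewrite ?cP // bigcup_sup.
Qed.

Lemma matroid_cycle_ground X : matroid_cycle M X -> X \subset ground M.
Proof.
case=> P cP ->; apply/bigcupsP=> K /cP /circuit_dependent.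
by case/andP.
Qed.

Lemma rank_attained : exists2 J, indep M J & #|J| = rank M.
Proof.
have [|J iJ rJ] := @eq_bigmax_cond _ (indep M) (fun J : {set T} => #|J|).
  by apply/card_gt0P; exists set0; exact: indep0.
by exists J; rewrite // -rJ.
Qed.

End Matroids.

Section UniqueUnion.
Variables (T I : finType) (A : I -> {set T}).
Implicit Types S : {set I}.

Lemma unique_unionP S e :
  reflect (exists2 i, i \in S /\ e \in A i &
             forall j, j \in S -> e \in A j -> j = i)
          (e \in unique_union A S).
Proof.
rewrite inE; apply: (iffP cards1P) => [[i Si] | [i [iS ei] uniq_i]].
  exists i => [|j jS ej]; last by apply/set1P; rewrite -Si inE jS.
  by apply/andP; have := set11 i; rewrite -[in X in X -> _]Si inE.
exists i; apply/setP=> j; rewrite !inE.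
by apply/andP/eqP => [[] | ->] //; exact: uniq_i.
Qed.

(** Passing to a smaller index set can lose an element of the unique union only
    by losing the one member that contains it. *)
Lemma unique_union_subset S S' i e : S' \subset S -> i \in S' -> e \in A i ->
  e \in unique_union A S -> e \in unique_union A S'.
Proof.
move=> /subsetP sS iS ei /unique_unionP[k [kS ek] uniq_k].
apply/unique_unionP; exists i => // j jS ej.
by rewrite (uniq_k j (sS _ jS) ej) (uniq_k i (sS _ iS) ei).
Qed.

Lemma unique_union_setD_cover3 S S' e :
    S' \subset S -> unique_union A S' = unique_union A S ->
  e \in unique_union A (S :\: S') -> 3 <= #|[set i in S | e \in A i]|.
Proof.
move=> /setIidPr sS /setP/(_ e); rewrite !inE => eqS /eqP card1.
move: eqS; rewrite -(cardsID S' [set i in S | e \in A i]).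
have -> : [set i in S | e \in A i] :&: S' = [set i in S' | e \in A i].
  by rewrite -[in RHS]sS; apply/setP=> i; rewrite !inE andbAC.
have -> : [set i in S | e \in A i] :\: S' = [set i in S :\: S' | e \in A i].
  by apply/setP=> i; rewrite !inE andbA.
rewrite card1 addn1.
(* The count for S' is neither 0 nor 1, as either value would put e in exactly
   one of the two equal unique unions. *)
by case: #|_| => [|[|n]].
Qed.

End UniqueUnion.

Section GreatestSupport.
Variables (T : finType) (M : matroid T) (C : 'I_(corank M) -> {set T}).
Hypothesis hC : cycle_system C.
Variables (D : {set T}) (cD : circuit M D).
Implicit Types (S : {set 'I_(corank M)}) (X J : {set T}).

(** The loop invariant of the greedy deletion: [X] is the current ground set
    and [S] the current index set.  The independent set [J] bounds the corank
    of [X] by [#|S|], which keeps [S] nonempty. *)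
Lemma greatest_support_in S X J :
    D \subset X -> (forall i, i \in S -> C i \subset X) ->
    indep M J -> J \subset X -> #|X| <= #|S| + #|J| ->
    (forall S', unique_union C S' = D -> S' \subset S) ->
  exists2 S0, unique_union C S0 = D &
    forall S', unique_union C S' = D -> S' \subset S0.
Proof.
have [n] := ubnP #|S|.
elim: n S X J => // n IHn S X J ltSn sDX sCX iJ sJX leXSJ topS.
have [cycC depC] := hC.
have nzS : S != set0.
  apply/eqP=> S0; move: leXSJ; rewrite S0 cards0 add0n => leXJ.
  have /eqP JX : J == X by rewrite eqEcard sJX.
  have /andP[_ /negP[]] := circuit_dependent cD.
  by apply: indepS iJ; rewrite JX.
have [sUD | /subsetPn[e eU eD]] := boolP (unique_union C S \subset D).
  by exists S => //; case/minsetP: cD => _; apply; rewrite ?depC.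
have [i [iS ei] uniq_i] := unique_unionP _ _ _ eU.
have [K [cK sKC eK]] := matroid_cycle_circuit (cycC i) ei.
have [J' [iJ' sJ' leJ]] :=
  indep_avoid_circuit_elt cK (subset_trans sKC (sCX i iS)) eK iJ sJX.
have cardS := cardsD1 i S; rewrite iS add1n in cardS.
have eX : e \in X by apply: (subsetP (sCX i iS)).
apply: (IHn (S :\ i) (X :\ e) J') => //.
- by rewrite -ltnS -cardS.
- by rewrite subsetD1 sDX.
- move=> j /setD1P[ji jS]; rewrite subsetD1 sCX //=.
  by apply: contra ji => ej; rewrite (uniq_i j).
- rewrite -ltnS; move: leXSJ; rewrite (cardsD1 e X) eX add1n cardS.
  by move/leq_trans; apply; rewrite addSn ltnS leq_add2l.
- move=> S' US'; rewrite subsetD1 topS //=.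
  apply: contra eD => iS'; rewrite -US'.
  exact: unique_union_subset (topS _ US') iS' ei eU.
Qed.

Lemma greatest_support :
  exists2 S, unique_union C S = D &
    forall S', unique_union C S' = D -> S' \subset S.
Proof.
have [J iJ rJ] := rank_attained M.
apply: (@greatest_support_in setT (ground M) J) => //.
- by have /andP[] := circuit_dependent cD.
- by move=> i _; apply: matroid_cycle_ground; case: hC.
- exact: indep_ground iJ.
- by rewrite cardsT card_ord rJ addnC -leq_subLR.
Qed.

Lemma max_supportP :
  unique_union C (max_support C D) = D /\
    forall S, unique_union C S = D -> S \subset max_support C D.
Proof.
have [S0 US0 topS0] := greatest_support.
have maxS0 : maxset [in unique_union_fibre C D] S0.
  apply/maxsetP; split=> [|S]; first by rewrite /= inE US0.
  rewrite /= inE => /eqP US sS0.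
  by apply/eqP; rewrite eqEsubset sS0 topS0.
rewrite /max_support; case: pickP => [S | /(_ S0)]; last by rewrite maxS0.
case/maxsetP=> /=; rewrite inE => /eqP US maxS.
by rewrite -(maxS S0) ?topS0 //= inE US0.
Qed.

End GreatestSupport.

Theorem proposition6p7 (T : finType) (M : matroid T)
    (C : 'I_(corank M) -> {set T}) (hC : cycle_system C)
    (D : {set T}) (hD : circuit M D)
    (hind : indep M (cover_ge C D 3)) :
  #|unique_union_fibre C D| = 1.
Proof.
have [Umax topmax] := max_supportP hC hD.
apply/eqP/cards1P; exists (max_support C D).
apply/setP=> S; rewrite !inE; apply/eqP/eqP => [US | ->//].
have sS := topmax S US; apply/eqP; rewrite eqEsubset sS /= -setD_eq0.
apply: contraT => nzR.
have /andP[_ /negP[]] := hC.2 _ nzR.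
apply: indepS hind; apply/subsetP=> e eR; rewrite inE.
by apply: unique_union_setD_cover3 sS _ eR; rewrite US Umax.
Qed.
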